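(* The assignments $(-)_{\mathrm{top}}\colon \mathbf{Cmp}\to\mathbf{CGWH}$ and $\iota\colon\mathbf{CGWH}\to\mathbf{Cmp}$ (both acting as the identity on underlying maps of sets) are well-defined functors, and they form an adjoint pair with $(-)_{\mathrm{top}}$ left adjoint to $\iota$. Moreover, $\iota$ is fully faithful and $(\iota(-))_{\mathrm{top}}=\mathrm{id}_{\mathbf{CGWH}}$, so that $\mathbf{CGWH}$ may be regarded as a reflective subcategory of $\mathbf{Cmp}$. In particular, via $\mathbf{CHaus}\hookrightarrow\mathbf{CGWH}\hookrightarrow\mathbf{Cmp}$, every compact Hausdorff space $K$ may be canonically regarded as a compactological set endowed with the compactology of all compact subsets of $K$, each carrying the topology induced by $K$.
   Context: ''Compact'' always means quasi-compact and Hausdorff; $\mathbf{CHaus}$ is the category of compact spaces and continuous maps. A compactological set is a triple $(X,\mathscr C,(\tau_K)_{K\in\mathscr C})$ where $X$ is a set, $\mathscr C\subseteq\mathcal P(X)$ is a non-empty collection of subsets (the compactology), and each $\tau_K$ is a topology on $K$ such that $(K,\tau_K)$ is compact and: (1) $\bigcup_{K\in\mathscr C}K=X$; (2) for all $K_1,K_2\in\mathscr C$ there is $K_3\in\mathscr C$ with $K_1\cup K_2\subseteq K_3$; (3) if $K_1,K_2\in\mathscr C$ and $K_2\subseteq K_1$ then $\tau_{K_2}=\tau_{K_1}|_{K_2}$; (4) if $K_1\in\mathscr C$ and $K_2\subseteq (K_1,\tau_{K_1})$ is compact then $K_2\in\mathscr C$. A morphism $(X,\mathscr C,(\tau_K))\to(X',\mathscr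 C',(\tau_{K'}))$ is a map $f\colon X\to X'$ such that for all $K\in\mathscr C$ one has $f(K)\in\mathscr C'$ and $f|_K\colon(K,\tau_K)\to(f(K),\tau_{f(K)})$ is continuous. This defines the category $\mathbf{Cmp}$. A topological space $X$ is weak Hausdorff if $f(S)\subseteq X$ is closed for every compact space $S$ and continuous $f\colon S\to X$; it is compactly generated if a subset $F\subseteq X$ is closed iff $f^{-1}(F)$ is closed in $S$ for every compact space $S$ and continuous $f\colon S\to X$. $\mathbf{CGWH}$ is the category of compactly generated weak Hausdorff spaces with continuous maps. The functor $(-)_{\mathrm{top}}$ sends $(X,\mathscr C,(\tau_K))$ to $X$ with the final topology with respect to the inclusions $(K,\tau_K)\hookrightarrow X$, $K\in\mathscr C$. The functor $\iota$ sends a space $Y\in\mathbf{CGWH}$ to the set $Y$ with the collection of all compact subsets of $Y$, each with the induced topology. *)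

(* Defs.v *)
From HB Require Import structures.
From mathcomp Require Import all_boot all_classical.
From mathcomp Require Import topology_structure initial_topology subtype_topology.
From mathcomp Require Import compact separation_axioms.

Set Implicit Arguments.
Unset Strict Implicit.
Unset Printing Implicit Defensive.

Local Open Scope classical_set_scope.

Record category := Category {
  obj :> Type;
  hom : obj -> obj -> Type;
  idm : forall A, hom A A;
  compm : forall A B C, hom B C -> hom A B -> hom A C;
  compm1 : forall A B (f : hom A B), compm f (idm A) = f;
  comp1m : forall A B (f : hom A B), compm (idm B) f = f;
  compmA : forall A B C D (f : hom A B) (g : hom B C) (h : hom C D),
    compm h (compm g f) = compm (compm h g) f
}.

Record functor (C D : category) := Functor {
  fobj :> C -> D;
  fmor : forall A B : C, hom A B -> hom (fobj A) (fobj B);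
  fmor1 : forall A : C, fmor (idm A) = idm (fobj A);
  fmorM : forall (A B E : C) (g : hom B E) (f : hom A B),
    fmor (compm g f) = compm (fmor g) (fmor f)
}.

Definition functor_id (C : category) : functor C C :=
  @Functor C C (fun A => A) (fun A B f => f)
    (fun A => erefl) (fun A B E g f => erefl).

Section functor_comp.
Context {C D E : category} (G : functor D E) (F : functor C D).

Let fmor_comp (A B : C) (f : hom A B) : hom (G (F A)) (G (F B)) :=
  fmor G (fmor F f).

Let fmor_comp1 (A : C) : fmor_comp (idm A) = idm (G (F A)).
Proof. by rewrite /fmor_comp !fmor1. Qed.

Let fmor_compM (A B A' : C) (g : hom B A') (f : hom A B) :
  fmor_comp (compm g f) = compm (fmor_comp g) (fmor_comp f).
Proof. by rewrite /fmor_comp !fmorM. Qed.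

Definition functor_comp : functor C E :=
  @Functor C E (fun A => G (F A)) fmor_comp fmor_comp1 fmor_compM.

End functor_comp.

Definition fully_faithful (C D : category) (F : functor C D) : Prop :=
  forall A B : C, bijective (@fmor C D F A B).

Definition left_adjoint (C D : category) (F : functor C D) (G : functor D C)
    : Prop :=
  exists phi : forall (A : C) (B : D), hom (F A) B -> hom A (G B),
    (forall A B, bijective (phi A B)) /\
    (forall (A A' : C) (B B' : D)
            (f : hom A' A) (g : hom (F A) B) (h : hom B B'),
      phi A' B' (compm h (compm g (fmor F f)))
      = compm (fmor G h) (compm (phi A B g) f)).

Definition reflective_embedding (C D : category) (G : functor D C) : Prop :=
  [/\ fully_faithful G, injective (fobj G)
    & exists F : functor C D, left_adjoint F G].

Record topology_on (T : Type) := TopologyOn {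
  opens : set (set T);
  opensT : opens setT;
  opensI : setI_closed opens;
  opens_bigcup : forall (I : Type) (g : I -> set T),
    (forall i, opens (g i)) -> opens (\bigcup_i g i)
}.

Definition space (T : Type) (t : topology_on T) : Type := T.

HB.instance Definition _ (T : choiceType) (t : topology_on T) :=
  Choice.copy (space t) T.
HB.instance Definition _ (T : choiceType) (t : topology_on T) :=
  isOpenTopological.Build (space t)
    (opensT t) (@opensI _ t) (@opens_bigcup _ t).

Lemma topology_of_bigcup (T : topologicalType) (I : Type) (g : I -> set T) :
  (forall i, open (g i)) -> open (\bigcup_i g i).
Proof. by move=> go; apply: bigcup_open => i _; exact: go. Qed.

Definition topology_of (T : topologicalType) : topology_on T :=
  TopologyOn (@openT T) (@openI T) (@topology_of_bigcup T).

Definition induced (S : choiceType) (T : topologicalType) (f : S -> T)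
    : topology_on S :=
  topology_of (initial_topology f).

(* The library's [compact] is quasi-compactness. *)
Definition compact_space (T : topologicalType) : Prop :=
  compact [set: T] /\ hausdorff_space T.

(* [A], coerced to a type, carries the subspace topology. *)
Definition compact_subset (T : topologicalType) (A : set T) : Prop :=
  compact_space A.

Definition weak_hausdorff (X : topologicalType) : Prop :=
  forall (S : topologicalType) (f : S -> X),
    compact_space S -> continuous f -> closed (range f).

Definition compactly_generated (X : topologicalType) : Prop :=
  forall F : set X,
    closed F <->
    (forall (S : topologicalType) (f : S -> X),
       compact_space S -> continuous f -> closed (f @^-1` F)).

Definition is_cgwh (X : topologicalType) : Prop :=
  compactly_generated X /\ weak_hausdorff X.

Record top_obj (P : topologicalType -> Prop) := TopObj {
  top_sort :> topologicalType;
  top_objP : P top_sort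
}.

Record top_hom (X Y : topologicalType) := TopHom {
  top_hom_fun :> X -> Y;
  top_hom_continuous : continuous top_hom_fun
}.

Lemma top_hom_eq (X Y : topologicalType) (f g : top_hom X Y) :
  top_hom_fun f = top_hom_fun g -> f = g.
Proof.
case: f g => [f cf] [g cg] /= fg; move: cf cg; rewrite fg => cf cg.
by congr TopHom; exact: Prop_irrelevance.
Qed.

Definition top_hom_id (X : topologicalType) : top_hom X X :=
  TopHom (fun x => @cvg_id _ (nbhs x)).

Lemma top_hom_comp_subproof (X Y Z : topologicalType)
  (g : top_hom Y Z) (f : top_hom X Y) : continuous (g \o f).
Proof. by move=> x; apply: continuous_comp; exact: top_hom_continuous. Qed.

Definition top_hom_comp (X Y Z : topologicalType)
    (g : top_hom Y Z) (f : top_hom X Y) : top_hom X Z :=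
  TopHom (@top_hom_comp_subproof X Y Z g f).

Program Definition full_top (P : topologicalType -> Prop) : category :=
  @Category (top_obj P) (fun X Y => top_hom X Y)
    (fun X => top_hom_id X) (fun X Y Z g f => top_hom_comp g f) _ _ _.
Next Obligation. by move=> *; exact: top_hom_eq. Qed.
Next Obligation. by move=> *; exact: top_hom_eq. Qed.
Next Obligation. by move=> *; exact: top_hom_eq. Qed.

Definition CHaus : category := full_top compact_space.
Definition CGWH : category := full_top is_cgwh.

Definition full_top_incl (P Q : topologicalType -> Prop)
    (PQ : forall X, P X -> Q X) : functor (full_top P) (full_top Q) :=
  @Functor (full_top P) (full_top Q)
    (fun X => TopObj (PQ _ (top_objP X))) (fun X Y f => f)
    (fun X => erefl) (fun X Y Z g f => erefl).

Definition sub_incl (T : Type) (A B : set T) (AB : A `<=` B) (x : A) : B :=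
  exist _ (val x) (mem_set (AB _ (set_mem (valP x)))).

Definition image_map (S T : Type) (f : S -> T) (A : set S) (x : A) : f @` A :=
  exist _ (f (val x)) (mem_set (imageP f (set_mem (valP x)))).

(* [cmp_set] is a [choiceType] because every [topologicalType] is one. *)
Record cmp_data := CmpData {
  cmp_set :> choiceType;
  cpts : set (set cmp_set);
  ctop : forall K : set cmp_set, cpts K -> topology_on K
}.

Arguments cpts : clear implicits.

Record is_compactological (X : cmp_data) : Prop := IsCompactological {
  cpts_nonempty : cpts X !=set0;
  cpts_compact : forall (K : set X) (hK : cpts X K),
    compact_space (space (ctop hK));
  cpts_cover : \bigcup_(K in cpts X) K = [set: X];
  cpts_directed : forall K1 K2 : set X, cpts X K1 -> cpts X K2 ->
    exists2 K3 : set X, cpts X K3 & K1 `|` K2 `<=` K3;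
  cpts_restrict : forall (K1 K2 : set X) (h1 : cpts X K1) (h2 : cpts X K2)
    (K21 : K2 `<=` K1),
    ctop h2 = induced (sub_incl K21 : K2 -> space (ctop h1));
  cpts_sub : forall (K1 : set X) (h1 : cpts X K1) (K2 : set (space (ctop h1))),
    compact_subset K2 -> cpts X [set val (x : K1) | x in K2]
}.

Record cmp_obj := CmpObj {
  cmp_sort :> cmp_data;
  cmp_objP : is_compactological cmp_sort
}.

Definition cmp_map (X Y : cmp_data) (f : X -> Y) : Prop :=
  forall (K : set X) (hK : cpts X K), exists hfK : cpts Y (f @` K),
    continuous (@image_map X Y f K : space (ctop hK) -> space (ctop hfK)).

Record cmp_hom (X Y : cmp_data) := CmpHom {
  cmp_fun :> X -> Y;
  cmp_funP : cmp_map cmp_fun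
}.

Lemma cmp_hom_eq (X Y : cmp_data) (f g : cmp_hom X Y) :
  cmp_fun f = cmp_fun g -> f = g.
Proof.
case: f g => [f cf] [g cg] /= fg; move: cf cg; rewrite fg => cf cg.
by congr CmpHom; exact: Prop_irrelevance.
Qed.

(* [f @` K] is only propositionally equal to, e.g., [K] for [f = id]; [L]
   stands for such a propositionally equal set. *)
Lemma cmp_map_on (X Y : cmp_data) (f : X -> Y) (K : set X) (hK : cpts X K)
    (L : set Y) (hL : cpts Y L) (g : K -> L) :
  f @` K = L -> (forall x : K, val (g x) = f (val x)) ->
  continuous (g : space (ctop hK) -> space (ctop hL)) ->
  exists hfK : cpts Y (f @` K),
    continuous (@image_map X Y f K : space (ctop hK) -> space (ctop hfK)).
Proof.
move=> fKL; case: _ / fKL hL g => hL g gE gc; exists hL.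
by rewrite (_ : @image_map X Y f K = g)//; apply/funext => x; apply/val_inj.
Qed.

Lemma cmp_map_id (X : cmp_data) : cmp_map (fun x : X => x).
Proof.
move=> K hK; apply: (@cmp_map_on _ _ _ _ hK K hK id) => //.
  exact: image_id.
by move=> x; exact: cvg_id.
Qed.

Lemma cmp_map_comp (X Y Z : cmp_data) (g : cmp_hom Y Z) (f : cmp_hom X Y) :
  cmp_map (g \o f).
Proof.
move=> K hK; have [hfK fc] := cmp_funP f hK; have [hgfK gc] := cmp_funP g hfK.
apply: (@cmp_map_on _ _ _ _ hK _ hgfK
  (@image_map _ _ g (f @` K) \o @image_map _ _ f K)) => //.
  by rewrite image_comp.
by move=> x; apply: (@continuous_comp (space (ctop hK)) (space (ctop hfK))
  (space (ctop hgfK))); [exact: fc|exact: gc].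
Qed.

Program Definition Cmp : category :=
  @Category cmp_obj (fun X Y => cmp_hom X Y)
    (fun X => CmpHom (@cmp_map_id X))
    (fun X Y Z g f => CmpHom (@cmp_map_comp X Y Z g f)) _ _ _.
Next Obligation. by move=> *; exact: cmp_hom_eq. Qed.
Next Obligation. by move=> *; exact: cmp_hom_eq. Qed.
Next Obligation. by move=> *; exact: cmp_hom_eq. Qed.

Definition final_opens (X : cmp_data) : set (set X) :=
  [set U | forall (K : set X) (hK : cpts X K),
     opens (ctop hK) [set x : K | U (val x)]].

Lemma final_opensT (X : cmp_data) : final_opens [set: X].
Proof. by move=> K hK; exact: opensT. Qed.

Lemma final_opensI (X : cmp_data) : setI_closed (@final_opens X).
Proof. by move=> U V oU oV K hK; apply: opensI; [exact: oU|exact: oV]. Qed.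

Lemma final_opens_bigcup (X : cmp_data) (I : Type) (g : I -> set X) :
  (forall i, final_opens (g i)) -> final_opens (\bigcup_i g i).
Proof.
move=> go K hK; rewrite [Z in opens _ Z](_ : _ =
  \bigcup_i [set x : K | g i (val x)]) //.
by apply: opens_bigcup => i; exact: go.
Qed.

Definition final_topology (X : cmp_data) : topology_on X :=
  TopologyOn (@final_opensT X) (@final_opensI X) (@final_opens_bigcup X).

Definition top_space (X : cmp_data) : topologicalType :=
  space (final_topology X).

Definition iota_data (Y : topologicalType) : cmp_data :=
  @CmpData Y [set K : set Y | compact_subset K]
    (fun K _ => topology_of (K : topologicalType)).

(* The section variables are the facts that make the assignments, which keep
   underlying maps unchanged, well-defined functors. *)
Section functors.

Variable top_cgwh : forall X : Cmp, is_cgwh (top_space X).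
Variable top_continuous : forall (X Y : Cmp) (f : X -> Y),
  cmp_map f -> continuous (f : top_space X -> top_space Y).

Program Definition top_functor : functor Cmp CGWH :=
  @Functor Cmp CGWH
    (fun X => TopObj (top_cgwh X))
    (fun X Y f => TopHom (top_continuous (@cmp_funP X Y f))) _ _.
Next Obligation. by move=> *; exact: top_hom_eq. Qed.
Next Obligation. by move=> *; exact: top_hom_eq. Qed.

Variable iota_cmp : forall Y : CGWH, is_compactological (iota_data Y).
Variable iota_cmp_map : forall (Y Z : CGWH) (f : Y -> Z),
  continuous f -> cmp_map (f : iota_data Y -> iota_data Z).

Program Definition iota_functor : functor CGWH Cmp :=
  @Functor CGWH Cmp
    (fun Y => CmpObj (iota_cmp Y))
    (fun Y Z f => CmpHom (iota_cmp_map (@top_hom_continuous Y Z f))) _ _.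
Next Obligation. by move=> *; exact: cmp_hom_eq. Qed.
Next Obligation. by move=> *; exact: cmp_hom_eq. Qed.

End functors.

(* Main.v *)
Require Import Defs.
From mathcomp Require Import all_boot all_classical.
From mathcomp Require Import topology_structure initial_topology subtype_topology.
From mathcomp Require Import compact separation_axioms subspace_topology.
From mathcomp Require Import sigT_topology.

(* Every member [K] of a compactology is closedly embedded in the final
   topology: two members lie in a third, where they are closed, being compact.
   So for [f] from a compact space, [f @^-1` K] is compact and the trace on [K]
   of the range of [f] is a compact subset of [K]; this gives weak
   Hausdorffness. Conversely, in a weak Hausdorff space [Y] a map from a compact
   space is closed, and since its source is normal its range is Hausdorff. This
   makes images and finite unions of compact subsets compact, so that [iota Y]
   is a compactological set, and it lets the test maps in the definition of
   compact generation factor through compact subsets, so that the final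
   topology of [iota Y] is that of [Y]. *)

Set Implicit Arguments.
Unset Strict Implicit.
Unset Printing Implicit Defensive.

Local Open Scope classical_set_scope.

(** * Equality of topologies and of topological structures *)

Lemma topology_on_eq (T : Type) (s t : topology_on T) :
  opens s = opens t -> s = t.
Proof.
case: s t => [o oT oI oU] [o' oT' oI' oU'] /= oo'.
case: _ / oo' oT' oI' oU' => oT' oI' oU'.
by congr TopologyOn; exact: Prop_irrelevance.
Qed.

(** The open sets determine the neighbourhood filters through the field [nE], and the remaining
    fields are proofs. The choice structure is shared, so nothing else can differ. *)
Lemma topological_class_eq (T : Type) (c : hasChoice.axioms_ T)
    (e : Equality.mixin_of T) (s : selfFiltered.axioms_ T)
    (n n' : isFiltered.axioms_ T T)
    (m : Nbhs_isTopological.axioms_ T c e s n)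
    (m' : Nbhs_isTopological.axioms_ T c e s n') :
  Nbhs_isTopological.open m = Nbhs_isTopological.open m' ->
  Topological.Class m = Topological.Class m'.
Proof.
case: n m => n [o np nE oE]; case: n' m' => n' [o' np' nE' oE'] /= oo'.
have nn' : n = n'.
  by apply/funext => x; apply: etrans (nE x) _; rewrite oo'; exact/esym/nE'.
case: _ / oo' np' nE' oE'; case: _ / nn' => np' nE' oE'.
by congr (Topological.Class (Nbhs_isTopological.Axioms_ _ _ _ _));
  exact: Prop_irrelevance.
Qed.

(** Comparing classes rather than packed spaces keeps the carrier fixed, so that maps between the
    spaces can later be compared without transport. *)
Lemma space_class_eq (X : topologicalType) (t : topology_on X) :
  opens t = open ->
  Topological.class (space t) = Topological.class X :> Topological.axioms_ X.
Proof.
case: X t => T [c e [] n m] t /= to.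
exact: (@topological_class_eq T c e _ _ n
  (Topological.topology_structure_Nbhs_isTopological_mixin
    (Topological.class (space t))) m to).
Qed.

Lemma space_eq (X : topologicalType) (t : topology_on X) :
  opens t = open -> (space t : topologicalType) = X.
Proof.
case: X t => T c t to; congr Topological.Pack.
exact: (@space_class_eq (Topological.Pack c)).
Qed.

(** * Subspaces and compact sets *)

Lemma set_type_continuousP (S Y : topologicalType) (A : set Y) (g : S -> A) :
  continuous g <-> continuous (\val \o g).
Proof.
split=> [gc x|/continuousP gc].
  by apply: continuous_comp; [exact: gc|exact: initial_continuous].
by apply/continuousP => _ [U oU <-]; exact: gc.
Qed.

Lemma set_val_continuous (Y : topologicalType) (A : set Y) :
  continuous (\val : A -> Y).
Proof. exact: initial_continuous. Qed.

(** A proper filter on the subtype is pushed forward along [\val]. Its cluster point in [A] lifts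
    back because neighbourhoods in the subtype contain traces of open sets of [Y]. *)
Lemma compact_set_type (Y : topologicalType) (A : set Y) :
  compact A -> compact [set: A].
Proof.
move=> cA F FF _; have FA : F (\val @^-1` A).
  by apply: filterS (@filterT _ F _) => x _; exact: set_mem (valP x).
have [x [Ax xF]] := cA _ (fmap_proper_filter \val FF) FA.
exists (exist _ x (mem_set Ax)); split=> // B U FB.
rewrite nbhsE => -[_ [[V oV <-] Vx] VU].
have [] := xF (\val @` B) V.
- by rewrite nbhs_simpl /=; apply: filterS FB; exact: preimage_image.
- exact: open_nbhs_nbhs.
by move=> _ [[b Bb <-] Vb]; exists b; split=> //; exact: VU.
Qed.

Lemma compact_space_range (S Y : topologicalType) (f : S -> Y) :
  compact_space S -> continuous f -> compact (range f).
Proof.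
move=> [cS _] fc; apply: continuous_compact => //.
exact: continuous_subspaceT.
Qed.

Lemma compact_closed_image (S Y : topologicalType) (f : S -> Y) (C : set S) :
  compact_space S -> hausdorff_space Y -> continuous f -> closed C ->
  closed (f @` C).
Proof.
move=> [cS _] hY fc cC; apply: compact_closed => //.
apply: continuous_compact; first exact: continuous_subspaceT.
exact: subclosed_compact cC cS _.
Qed.

Lemma set_type_hausdorff (Y : topologicalType) (A : set Y) :
  hausdorff_space Y -> hausdorff_space A.
Proof.
move=> hY p q pq; apply/val_inj/hY => U V Up Vq.
have [x [Ux Vx]] := pq _ _ (set_val_continuous Up) (set_val_continuous Vq).
by exists (\val x).
Qed.

Lemma continuous_closed_preimage (S T : topologicalType) (f : S -> T)
    (C : set T) :
  continuous f -> closed C -> closed (f @^-1` C).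
Proof. by move=> /continuous_closedP fc; exact: fc. Qed.

Lemma compact_space_topology_of (X : topologicalType) :
  compact_space X -> compact_space (space (topology_of X)).
Proof. by rewrite (space_eq (t := topology_of X)). Qed.

Lemma range_comp_val (S Y : Type) (f : S -> Y) (A : set S) :
  range (f \o (\val : A -> S)) = f @` A.
Proof.
apply/seteqP; split=> [_ [x _ <-]|_ [x Ax <-]].
  by apply: imageP; exact: set_valP.
by exists (exist _ x (mem_set Ax)).
Qed.

Lemma compact_space_closed_subset (S : topologicalType) (C : set S) :
  compact_space S -> closed C -> compact_subset C.
Proof.
move=> [cS hS] cC; split; last exact: set_type_hausdorff.
by apply: compact_set_type; exact: subclosed_compact cC cS _.
Qed.

(** * Maps from compact spaces to weak Hausdorff spaces *)

Section weak_hausdorff.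
Variables (S Y : topologicalType) (f : S -> Y).
Hypotheses (cS : compact_space S) (wY : weak_hausdorff Y) (fc : continuous f).

Lemma weak_hausdorff_closed_image (C : set S) : closed C -> closed (f @` C).
Proof.
move=> cC; rewrite -range_comp_val.
apply: wY; first exact: compact_space_closed_subset.
by move=> x; apply: continuous_comp; [exact: set_val_continuous|exact: fc].
Qed.

Lemma weak_hausdorff_fiber_closed (s : S) : closed [set t | f t = f s].
Proof.
apply: (continuous_closedP f).1 fc [set f s] _.
(* The point [f s] is closed in [Y], being the image of the closed point [s]. *)
rewrite -image_set1; apply: weak_hausdorff_closed_image.
exact/accessible_closed_set1/hausdorff_accessible/cS.2.
Qed.

(* [f] is a closed map from a normal space, so disjoint fibres have disjoint
   neighbourhoods of the form [f @^-1` V]. *)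
Lemma compact_subset_range : compact_subset (range f).
Proof.
split; first exact/compact_set_type/compact_space_range.
move=> p q clpq; apply: contrapT => pq.
have [s _ fs] := set_valP p; have [t _ ft] := set_valP q.
have st : f s <> f t by rewrite fs ft => /val_inj.
pose P := [set x | f x = f s]; pose Q := [set x | f x = f t].
have cP : closed P by exact: weak_hausdorff_fiber_closed.
(* Normality of [S] gives a neighbourhood [U] of the fibre [P] whose closure misses the fibre
   [Q]. *)
have [|U PU UQ] := compact_normal cS.2 cS.1 cP (_ : set_nbhs P (~` Q)).
  apply/set_nbhsP; exists (~` Q); split=> //.
    by apply: closed_openC; exact: weak_hausdorff_fiber_closed.
  by move=> x Px Qx; exact: st (etrans (esym Px) Qx).
have [C [oC PC CU]] := (set_nbhsP _ _).1 PU.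
pose D := ~` closure U.
have oD : open D by exact/closed_openC/closed_closure.
have QD x : Q x -> D x by move=> Qx /UQ.
(* [V B] consists of the points of the range whose whole fibre lies in [B]; it is open for open [B]
   because [f] is a closed map. *)
pose V (B : set S) : set (range f) := \val @^-1` (~` (f @` (~` B))).
have oV B : open B -> open (V B).
  move=> oB; exists (~` (f @` (~` B))) => //.
  exact/closed_openC/weak_hausdorff_closed_image/open_closedC.
have [||r [VC VD]] := clpq (V C) (V D).
- apply: open_nbhs_nbhs; split; first exact: oV.
  by move=> [x nCx xp]; apply/nCx/PC; rewrite /P/= xp fs.
- apply: open_nbhs_nbhs; split; first exact: oV.
  by move=> [x nDx xq]; apply/nDx/QD; rewrite /Q/= xq ft.
have [x _ fx] := set_valP r.
have Cx : C x by apply: contrapT => nCx; apply: VC; exists x.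
have Dx : D x by apply: contrapT => nDx; apply: VD; exists x.
exact/Dx/subset_closure/CU.
Qed.

End weak_hausdorff.

Lemma compact_subset_image (Y Z : topologicalType) (f : Y -> Z) (K : set Y) :
  weak_hausdorff Z -> continuous f -> compact_subset K ->
  compact_subset (f @` K).
Proof.
move=> wZ fc cK; rewrite -range_comp_val; apply: compact_subset_range => //.
by move=> x; apply: continuous_comp; [exact: set_val_continuous|exact: fc].
Qed.

(** As [Y] is only weak Hausdorff, separation of the union is not inherited from [Y]. The union is
    the range of a map from the disjoint sum of [K] and [L], which is a compact space, so
    [compact_subset_range] applies. *)
Lemma compact_subset_setU (Y : topologicalType) (K L : set Y) :
  weak_hausdorff Y -> compact_subset K -> compact_subset L ->
  compact_subset (K `|` L).
Proof.
move=> wY [cK hK] [cL hL].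
pose X (b : bool) : topologicalType := if b then K else L.
pose v (b : bool) : X b -> Y := if b return X b -> Y then \val else \val.
have vE b : range (@v b) = if b then K else L.
  by case: b; rewrite -[RHS]image_id; exact: (range_comp_val id).
rewrite (_ : _ `|` _ = range (fun z : {b & X b} => v (tag z) (tagged z))).
  apply: compact_subset_range => //; last first.
    by apply: (@sigT_continuous _ _ _ v) => -[]; exact: set_val_continuous.
  split; last by apply: sigT_hausdorff => -[].
  by apply: sigT_compact => [|[]]//; exact: finite_finset.
apply/seteqP; split=> [y|_ [[b x] _ <-]].
  rewrite -(vE true) -(vE false).
  by case=> -[x _ <-]; [exists (existT X true x)|exists (existT X false x)].
by case: b x => x; [left|right]; exact: set_valP.
Qed.

(** * The final topology of a compactology *)

Lemma open_topE (X : cmp_data) (U : set (top_space X)) :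
  open U = final_opens U.
Proof. by []. Qed.

Section top_space.
Variable X : cmp_data.
Hypothesis hX : is_compactological X.

Lemma closed_topP (F : set (top_space X)) :
  closed F <-> forall (K : set X) (hK : cpts X K),
    closed (\val @^-1` F : set (space (ctop hK))).
Proof.
rewrite -openC open_topE.
by split=> oF K hK; have := oF K hK; rewrite -openC.
Qed.

Lemma top_space_incl_continuous (K : set X) (hK : cpts X K) :
  continuous (\val : space (ctop hK) -> top_space X).
Proof. by apply/continuousP => U oU; exact: oU. Qed.

Lemma sub_incl_continuous (K L : set X) (hK : cpts X K) (hL : cpts X L)
    (KL : K `<=` L) :
  continuous (sub_incl KL : space (ctop hK) -> space (ctop hL)).
Proof.
apply/continuousP => U oU; rewrite (cpts_restrict hX hL hK KL).
by exists U.
Qed.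

Lemma top_space_closed_image (K : set X) (hK : cpts X K)
    (C : set (space (ctop hK))) :
  closed C -> closed (\val @` C : set (top_space X)).
Proof.
move=> cC; apply/closed_topP => L hL.
have [M hM KLM] := cpts_directed hX hK hL.
have KM : K `<=` M by move=> x Kx; apply: KLM; left.
have LM : L `<=` M by move=> x Lx; apply: KLM; right.
(* The trace on [L] is computed inside [M], where the image of [C] is compact and hence closed. *)
rewrite (_ : _ @^-1` _ = sub_incl LM @^-1` (sub_incl KM @` C)).
  apply: (@continuous_closed_preimage (space (ctop hL)) (space (ctop hM))).
    exact: sub_incl_continuous.
  apply: (@compact_closed_image (space (ctop hK)) (space (ctop hM))) => //.
  - exact: cpts_compact.
  - exact: (cpts_compact hX hM).2.
  - exact: sub_incl_continuous.
apply/seteqP; split=> x [y Cy yx]; exists y => //.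
  exact: val_inj.
by rewrite -[LHS]/(\val (sub_incl KM y)) yx.
Qed.

Lemma top_space_cgwh : is_cgwh (top_space X).
Proof.
split=> [F|S f cS fc].
  split=> [cF S f _ fc|cF]; first exact: continuous_closed_preimage.
  (* The inclusions of the members are themselves test maps, and they detect the closed sets of the
     final topology. *)
  apply/closed_topP => K hK; apply: cF; first exact: cpts_compact.
  exact: top_space_incl_continuous.
apply/closed_topP => K hK.
have cK : closed (K : set (top_space X)).
  rewrite (_ : K = \val @` [set: K]).
    by apply: (top_space_closed_image (hK := hK)); exact: closedT.
  by rewrite -[LHS]image_id -(range_comp_val id).
pose P : set S := f @^-1` K.
have cP : closed P by exact: continuous_closed_preimage.
have PK (x : P) : f (\val x) \in K by apply: mem_set; exact: (set_valP x).
pose g (x : P) : space (ctop hK) := exist _ (f (\val x)) (PK x).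
(* A closed subset of [K] is closed in the final topology, so its preimage under [f] is closed. *)
have gc : continuous g.
  apply/continuous_closedP => C cC.
  rewrite (_ : g @^-1` C = \val @^-1` (f @^-1` (\val @` C))).
      apply: continuous_closed_preimage; first exact: set_val_continuous.
    apply: continuous_closed_preimage => //.
    exact: top_space_closed_image.
  apply/seteqP; split=> x /=; first by exists (g x).
  by move=> [y Cy yx]; rewrite (_ : g x = y)//; exact: val_inj.
rewrite (_ : _ @^-1` _ = range g).
  apply: compact_closed; first exact: (cpts_compact hX hK).2.
  by apply: compact_space_range => //; exact: compact_space_closed_subset.
apply/seteqP; split=> [x [s _ fs]|_ [s _ <-]]; last by exists (\val s).
have Ps : s \in P by apply: mem_set; rewrite /P/= fs; exact: set_valP.
by exists (exist _ s Ps) => //; exact: val_inj.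
Qed.

End top_space.

Lemma top_space_continuous (X Y : cmp_data) (f : X -> Y) :
  cmp_map f -> continuous (f : top_space X -> top_space Y).
Proof.
move=> fP; apply/continuousP => U; rewrite 2!open_topE => oU K hK.
have [hfK /continuousP fc] := fP K hK; exact: fc (oU _ hfK).
Qed.

(** * The compactology of compact subsets *)

Lemma iota_data_compactological (Y : topologicalType) :
  weak_hausdorff Y -> is_compactological (iota_data Y).
Proof.
move=> wY; split.
- exists set0; split; first exact/compact_set_type/compact0.
  by move=> p; have := set_valP p.
- by move=> K hK; exact: compact_space_topology_of.
- rewrite -subTset => y _; exists [set y] => //.
  split; first exact/compact_set_type/compact_set1.
  by move=> p q _; apply: val_inj; rewrite (set_valP p) (set_valP q).
- by move=> K L cK cL; exists (K `|` L) => //; exact: compact_subset_setU.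
(* Restricting from [Y] to [K] and then to [L] gives the same open sets as restricting to [L]
   directly. *)
- move=> K L hK hL LK; apply/topology_on_eq/seteqP.
  split=> [_ [U oU <-]|_ [_ [U oU <-] <-]]; last by exists U.
  by exists (\val @^-1` U) => //; exists U.
- move=> K hK L hL; apply: compact_subset_image => //.
  by apply/continuousP => U oU; exists U.
Qed.

(** This is the transposition of the adjunction; taking [iota_data] of a space for [X], it also
    yields the action of [iota] on morphisms. *)
Lemma cmp_map_iota (X : cmp_data) (Y : topologicalType) (f : X -> Y) :
  is_compactological X -> weak_hausdorff Y ->
  continuous (f : top_space X -> Y) -> cmp_map (f : X -> iota_data Y).
Proof.
move=> hX wY fc K hK.
have fKc : continuous (f \o \val : space (ctop hK) -> Y).
  move=> x; apply: (@continuous_comp (space (ctop hK)) (top_space X) Y);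
    [exact: top_space_incl_continuous|exact: fc].
have hfK : compact_subset (f @` K).
  rewrite -range_comp_val.
  apply: (@compact_subset_range (space (ctop hK))) => //.
  exact: cpts_compact.
exists hfK; apply/continuousP => _ [U oU <-].
exact: (continuousP _).1 fKc _ oU.
Qed.

Lemma continuous_cmp_map_iota (X : cmp_data) (Y : topologicalType)
    (f : X -> Y) :
  cmp_map (f : X -> iota_data Y) -> continuous (f : top_space X -> Y).
Proof.
move=> fP; apply/continuousP => U oU; rewrite open_topE => K hK.
have [hfK /continuousP fc] := fP K hK.
by apply: (fc (\val @^-1` U)); exists U.
Qed.

Lemma final_opens_iota (Y : topologicalType) :
  is_cgwh Y -> @final_opens (iota_data Y) = open.
Proof.
move=> [cgY wY]; apply/seteqP; split=> U oU; last by move=> K hK; exists U.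
rewrite -closedC; apply/cgY => S f cS fc.
pose K : set Y := range f.
have fK s : f s \in K by apply/mem_set/imageT.
pose g s : K := exist _ (f s) (fK s).
have gc : continuous g by exact/set_type_continuousP.
rewrite preimage_setC -openC setCK.
exact: (continuousP _).1 gc _ (oU K (compact_subset_range cS wY fc)).
Qed.

Lemma continuous_top_iota (Y Z : topologicalType) (f : Y -> Z) :
  is_cgwh Y -> continuous (f : top_space (iota_data Y) -> Z) <-> continuous f.
Proof.
move=> cY; rewrite 2!continuousP.
by split=> fc U /fc; rewrite open_topE final_opens_iota.
Qed.

Lemma compact_space_cgwh (K : topologicalType) : compact_space K -> is_cgwh K.
Proof.
move=> cK; split=> [F|S f cS fc].
  split=> [cF S f _ fc|cF]; first exact: continuous_closed_preimage.
  (* The identity of [K] is itself a test map. *)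
  exact: (cF K id cK (fun x => cvg_id)).
by apply: compact_closed; [exact: cK.2|exact: compact_space_range].
Qed.

(** * Equality of functors and full faithfulness *)

Lemma functor_id_eq (C : category) (F : functor C C) :
  (forall (A B : C) (f : hom A B),
    existT (fun X : C * C => hom X.1 X.2) (F A, F B) (fmor F f) =
    existT (fun X : C * C => hom X.1 X.2) (A, B) f) ->
  F = functor_id C.
Proof.
case: F => o m m1 mM /= mE.
(* Packing each morphism with its endpoints makes the hypothesis transport-free; at identities it
   gives the equality on objects. *)
have oE : id = o.
  apply/funext => A.
  exact: esym (congr1 (fun z => (tag z).1) (mE A A (idm A))).
case: _ / oE m m1 mM mE => m m1 mM mE.
have Em : (fun A B f => f) = m.
  do 2![apply/functional_extensionality_dep => ?]; apply/funext => f.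
  have := projT2_eq (mE _ _ f).
  (* The endpoints now agree definitionally, so proof irrelevance trivialises the transport between
     them. *)
  by move: (projT1_eq _) => /= e; rewrite (Prop_irrelevance e erefl) /= => ->.
case: _ / Em m1 mM mE => m1 mM mE.
by congr Functor; exact: Prop_irrelevance.
Qed.

(** Only the topological structures vary over the fixed carriers [T] and [U], so the two underlying
    maps have the same type and can be equated directly. *)
Lemma top_hom_existT_eq (P : topologicalType -> Prop) (T U : Type)
    (c c' : Topological.axioms_ T) (d d' : Topological.axioms_ U)
    (Pc : P (Topological.Pack c)) (Pc' : P (Topological.Pack c'))
    (Pd : P (Topological.Pack d)) (Pd' : P (Topological.Pack d'))
    (f : top_hom (Topological.Pack c) (Topological.Pack d))
    (g : top_hom (Topological.Pack c') (Topological.Pack d')) :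
  c = c' -> d = d' -> top_hom_fun f = (top_hom_fun g : T -> U) ->
  existT (fun X : top_obj P * top_obj P => top_hom X.1 X.2)
    (TopObj Pc, TopObj Pd) f = existT _ (TopObj Pc', TopObj Pd') g.
Proof.
move=> cc' dd'; case: _ / cc' Pc' g => Pc' g; case: _ / dd' Pd' g => Pd' g.
move=> /top_hom_eq ->.
by rewrite (Prop_irrelevance Pc Pc') (Prop_irrelevance Pd Pd').
Qed.

Lemma full_top_incl_fully_faithful (P Q : topologicalType -> Prop)
    (PQ : forall X, P X -> Q X) : fully_faithful (full_top_incl PQ).
Proof. by move=> A B; exists id. Qed.

Lemma fully_faithful_comp (C D E : category) (G : functor D E)
    (F : functor C D) :
  fully_faithful G -> fully_faithful F -> fully_faithful (functor_comp G F).
Proof. by move=> ffG ffF A B; apply: (bij_comp (ffG _ _) (ffF _ _)). Qed.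

Theorem theorem2p10 :
  exists (top_cgwh : forall X : Cmp, is_cgwh (top_space X))
         (top_continuous : forall (X Y : Cmp) (f : X -> Y),
            cmp_map f -> continuous (f : top_space X -> top_space Y))
         (iota_cmp : forall Y : CGWH, is_compactological (iota_data Y))
         (iota_cmp_map : forall (Y Z : CGWH) (f : Y -> Z),
            continuous f -> @cmp_map (iota_data Y) (iota_data Z) f)
         (chaus_cgwh : forall K : topologicalType,
            compact_space K -> is_cgwh K),
    let top : functor Cmp CGWH := top_functor top_cgwh top_continuous in
    let iota : functor CGWH Cmp := iota_functor iota_cmp iota_cmp_map in
    let chaus : functor CHaus CGWH := full_top_incl chaus_cgwh in
    let chaus_cmp : functor CHaus Cmp := functor_comp iota chaus in
    [/\ left_adjoint top iota,
        fully_faithful iota,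
        functor_comp top iota = functor_id CGWH,
        reflective_embedding iota
      & [/\ fully_faithful chaus,
            fully_faithful chaus_cmp
          & forall K : CHaus,
              cpts (chaus_cmp K) = [set A : set K | compact_subset A] /\
              forall (A : set K) (hA : cpts (chaus_cmp K) A),
                ctop hA = topology_of (A : topologicalType)]].
Proof.
have top_cgwh (X : Cmp) : is_cgwh (top_space X).
  exact: top_space_cgwh (cmp_objP X).
have top_continuous (X Y : Cmp) (f : X -> Y) :
    cmp_map f -> continuous (f : top_space X -> top_space Y).
  exact: top_space_continuous.
have iota_cmp (Y : CGWH) : is_compactological (iota_data Y).
  exact: iota_data_compactological (top_objP Y).2.
have iota_cmp_map (Y Z : CGWH) (f : Y -> Z) :
    continuous f -> @cmp_map (iota_data Y) (iota_data Z) f.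
  (* The final topology of [iota Y] is that of [Y], so [f] is continuous for it and can be
     transposed. *)
  move=> fc; apply: cmp_map_iota (iota_cmp Y) (top_objP Z).2 _.
  exact/(continuous_top_iota _ (top_objP Y)).
exists top_cgwh, top_continuous, iota_cmp, iota_cmp_map, compact_space_cgwh.
move=> top iota chaus chaus_cmp.
have adj : left_adjoint top iota.
  exists (fun (X : Cmp) (Y : CGWH) (g : top_hom (top_space X) Y) =>
    CmpHom (cmp_map_iota (cmp_objP X) (top_objP Y).2
      (@top_hom_continuous _ _ g))).
  split=> [X Y|X X' Y Y' f g h]; last exact: cmp_hom_eq.
  exists (fun g : cmp_hom X (iota_data Y) =>
    TopHom (continuous_cmp_map_iota (@cmp_funP _ _ g))) => g.
  - exact: top_hom_eq.
  - exact: cmp_hom_eq.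
have ff : fully_faithful iota.
  move=> Y Z.
  exists (fun g : cmp_hom (iota_data Y) (iota_data Z) =>
    @TopHom Y Z g ((continuous_top_iota _ (top_objP Y)).1
      (continuous_cmp_map_iota (@cmp_funP _ _ g)))) => g.
  - exact: top_hom_eq.
  - exact: cmp_hom_eq.
have top_iota : functor_comp top iota = functor_id CGWH.
  apply: functor_id_eq => -[[T c] cY] [[U d] cZ] f.
  apply: top_hom_existT_eq => //.
  - exact: (@space_class_eq (Topological.Pack c)
      (final_topology (iota_data (Topological.Pack c)))
      (final_opens_iota cY)).
  - exact: (@space_class_eq (Topological.Pack d)
      (final_topology (iota_data (Topological.Pack d)))
      (final_opens_iota cZ)).
have ffc : fully_faithful chaus by exact: full_top_incl_fully_faithful.
split=> //; first split=> //.
(* [iota] is injective on objects because [top] is a left inverse. *)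
- move=> Y Z YZ.
  have top_iotaE A : top (iota A) = A.
    by rewrite -[RHS]/(functor_id CGWH A) -top_iota.
  by rewrite -[Y]top_iotaE YZ top_iotaE.
- by exists top.
- by split=> //; exact: fully_faithful_comp.
Qed.
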